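(* Let $\tau=\tau_1\cdots\tau_k\in S_k$ and let $1\le i\le k$. Then $S_n(\hat\tau_{(i)})=S_n(\bar\tau_{(i)})$ for all $n=1,2,\dots$ if and only if $\tau_i$ is different from $\tau_{i-1}-1$, $\tau_{i-1}+1$, $\tau_{i+1}-1$ and $\tau_{i+1}+1$ (a condition involving $\tau_{i-1}$, resp. $\tau_{i+1}$, is regarded as vacuous when $i=1$, resp. $i=k$).
   Context: $S_n$ is the set of permutations of $\{1,\dots,n\}$ in one-line notation. For a string $q$ of distinct numbers, $red(q)$ is obtained by replacing the $j$-th smallest element of $q$ by $j$. For $\tau\in S_k$, $\tau\backslash\tau_i$ is the string obtained from $\tau$ by deleting the entry $\tau_i$. Barred avoidance: $\pi=\pi_1\cdots\pi_n$ avoids $\bar\tau_{(i)}$ if for every $j_1<\dots<j_{k-1}$ with $red(\pi_{j_1}\cdots\pi_{j_{k-1}})=red(\tau\backslash\tau_i)$ there is an index $j_*$ with $j_{i-1}<j_*<j_i$ (the bound $j_{i-1}$ being dropped if $i=1$ and $j_i$ being dropped if $i=k$) such that $red(\pi_{j_1}\cdots\pi_{j_{i-1}}\pi_{j_*}\pi_{j_i}\cdots\pi_{j_{k-1}})=\tau$. Hatted avoidance: $\pi$ avoids $\hat\tau_{(i)}$ if for every $j_1<\dots<j_{k-1}$ with $red(\pi_{j_1}\cdots\pi_{j_{k-1}})=red(\tau\backslash\tau_i)$ there are indices $t_1<\dots<t_k$ with $\{j_1,\dots,j_{k-1}\}\subseteq\{t_1,\dots,t_k\}$ and $red(\pi_{t_1}\cdots\pi_{t_k})=\tau$.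 $S_n(\bar\tau_{(i)})$ and $S_n(\hat\tau_{(i)})$ denote the sets of permutations in $S_n$ avoiding $\bar\tau_{(i)}$, respectively $\hat\tau_{(i)}$. *)

(* Defs.v *)
From mathcomp Require Import all_boot all_fingroup.

Set Implicit Arguments.
Unset Strict Implicit.
Unset Printing Implicit Defensive.

(* Conventions: positions are 0-based (elements of 'I_n), while the entries of
   a permutation, seen as a string, are the 1-based numbers 1, ..., n. *)

(* The string pi_{j_1} pi_{j_2} ... of entries of pi at the positions j. *)
Definition entries n (pi : 'S_n) (j : seq 'I_n) : seq nat :=
  [seq (pi x).+1 | x <- j].

Definition oneline n (pi : 'S_n) : seq nat := entries pi (enum 'I_n).

(* Meaningful for strings q of distinct numbers: the j-th smallest element,
   which has index j - 1 in the sorted string, is replaced by j. *)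
Definition red (q : seq nat) : seq nat :=
  [seq (index x (sort leq q)).+1 | x <- q].

Definition increasing n (j : seq 'I_n) : bool :=
  sorted (fun x y : 'I_n => x < y) j.

(* The string obtained from tau by deleting its entry at position i; the
   entries are distinct, so it is deleted by value. *)
Definition del_entry k (tau : 'S_k) (i : 'I_k) : seq nat :=
  rem (tau i).+1 (oneline tau).

Definition is_occurrence n k (pi : 'S_n) (tau : 'S_k) (i : 'I_k)
    (j : k.-1.-tuple 'I_n) : bool :=
  increasing j && (red (entries pi j) == red (del_entry tau i)).

(* As i is 0-based, there are i indices of j to the left of the inserted m:
   its left and right neighbours are the 0-based entries i - 1 and i of j,
   which exist when 0 < i, resp. i + 1 < k. *)
Definition avoids_bar n k (pi : 'S_n) (tau : 'S_k) (i : 'I_k) : bool :=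
  [forall j : k.-1.-tuple 'I_n, is_occurrence pi tau i j ==>
    [exists m : 'I_n,
      [&& (0 < i) ==> (nth m j i.-1 < m),
          (i.+1 < k) ==> (m < nth m j i)
        & red (entries pi (take i j ++ m :: drop i j)) == oneline tau]]].

Definition avoids_hat n k (pi : 'S_n) (tau : 'S_k) (i : 'I_k) : bool :=
  [forall j : k.-1.-tuple 'I_n, is_occurrence pi tau i j ==>
    [exists t : k.-tuple 'I_n,
      [&& increasing t, all (fun x => x \in t) j
        & red (entries pi t) == oneline tau]]].

Definition S_bar n k (tau : 'S_k) (i : 'I_k) : {set 'S_n} :=
  [set pi | avoids_bar pi tau i].

Definition S_hat n k (tau : 'S_k) (i : 'I_k) : {set 'S_n} :=
  [set pi | avoids_hat pi tau i].

(* Main.v *)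
Require Import Defs.
From mathcomp Require Import all_boot all_fingroup.
From mathcomp Require Import zify.

Set Implicit Arguments.
Unset Strict Implicit.
Unset Printing Implicit Defensive.

(** Deleting the entries at two different positions [i] and [p] of [tau] can
    only give the same pattern if [tau_i] differs by one from its neighbour on
    the side of [p]: at the same index, one pattern has [tau_i] and the other
    has that neighbour, each diminished by at most one.  Hence, under the
    condition on [tau_i], an occurrence of [tau] extending one of
    [tau \ tau_i] must insert its new entry at position [i].  Conversely, if
    [tau_l] is next to [tau_i] in both position and value, then [tau] itself
    avoids the hatted pattern but not the barred one: [tau \ tau_l] is an
    occurrence of [red (tau \ tau_i)] with no room for a new entry at position
    [i]. *)

(** * Deleting an entry by its index *)

Section Strings.

Variable T : Type.
Implicit Types (s : seq T) (p : nat).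

Definition delete_at p s := take p s ++ drop p.+1 s.

Lemma size_delete_at p s : p < size s -> size (delete_at p s) = (size s).-1.
Proof. by move=> lt_p; rewrite size_cat size_take size_drop lt_p; lia. Qed.

Lemma nth_delete_at x0 p s a :
  p < size s -> nth x0 (delete_at p s) a = nth x0 s (bump p a).
Proof.
move=> lt_p; rewrite nth_cat size_take lt_p /bump.
case: ltnP => [lt_ap | le_pa]; first by rewrite nth_take.
by rewrite nth_drop; congr nth; lia.
Qed.

Lemma count_delete_at (P : pred T) x0 p s : p < size s ->
  count P s = P (nth x0 s p) + count P (delete_at p s).
Proof.
move=> lt_p; rewrite -{1}(cat_take_drop p s) (drop_nth x0) // !count_cat /=.
lia.
Qed.

Lemma cat_delete_at x0 p s : p < size s ->
  take p (delete_at p s) ++ nth x0 s p :: drop p (delete_at p s) = s.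
Proof.
move=> lt_p; have sz : size (take p s) = p by rewrite size_takel // ltnW.
rewrite /delete_at take_cat drop_cat sz ltnn subnn take0 drop0 cats0.
by rewrite -drop_nth // cat_take_drop.
Qed.

End Strings.

Lemma map_delete_at (T U : Type) (f : T -> U) p s :
  map f (delete_at p s) = delete_at p (map f s).
Proof. by rewrite map_cat map_take map_drop. Qed.

Lemma rem_delete_at (T : eqType) (x : T) s : rem x s = delete_at (index x s) s.
Proof. exact: remE. Qed.

Lemma subseq_delete_at (T : eqType) p (s : seq T) : subseq (delete_at p s) s.
Proof.
rewrite -{2}(cat_take_drop p s); apply: cat_subseq => //.
by rewrite -addn1 addnC -drop_drop drop_subseq.
Qed.

(** * Reduction of strings, by counting smaller entries *)

Lemma index_sort (s : seq nat) x : x \in s ->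
  index x (sort leq s) = count (fun y => y < x) s.
Proof.
rewrite -(mem_sort leq) -(count_sort leq) => s_x.
have := sort_sorted leq_total s; elim: (sort leq s) s_x => //= y u IHu.
rewrite inE => s_x; rewrite path_sortedE; last exact: leq_trans.
case/andP=> /allP le_y sorted_u.
case: (eqVneq y x) s_x => [<- _ | ne_yx /= u_x].
  rewrite ltnn add0n; apply/esym/eqP; rewrite -leqn0 leqNgt -has_count.
  by apply/hasPn=> z /le_y; rewrite -leqNgt.
rewrite IHu //.
by rewrite ltn_neqAle ne_yx le_y.
Qed.

Lemma size_red s : size (red s) = size s.
Proof. exact: size_map. Qed.

Lemma nth_red s a : a < size s ->
  nth 0 (red s) a = (count (fun y => y < nth 0 s a) s).+1.
Proof. by move=> lt_a; rewrite (nth_map 0) // index_sort ?mem_nth. Qed.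

Lemma ltn_count_ltn (s : seq nat) x y : x \in s ->
  (count (fun z => z < x) s < count (fun z => z < y) s) = (x < y).
Proof.
move=> s_x; case: (ltnP x y) => [lt_xy | le_yx]; last first.
  by apply/negbTE; rewrite -leqNgt; apply: sub_count => z /= /leq_trans; apply.
have -> : count (fun z => z < y) s
        = count (fun z => z < x) s + count (fun z => x <= z < y) s.
  rewrite -count_predUI [X in _ + X](eq_count (a2 := pred0)) ?count_pred0
    ?addn0.
    by apply: eq_count => z /=; lia.
  by move=> z /=; lia.
rewrite -addn1 leq_add2l -has_count; apply/hasP; exists x => //.
by rewrite leqnn.
Qed.

(** Together with [eq_red], this replaces equality of reductions by order isomorphism, so that later
    arguments only compare pairs of entries. *)
Lemma red_nth_ltn s u a b : red s = red u -> a < size s -> b < size s ->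
  (nth 0 s a < nth 0 s b) = (nth 0 u a < nth 0 u b).
Proof.
move=> eq_red lt_a lt_b.
have sz : size s = size u by rewrite -(size_red s) eq_red size_red.
rewrite -(ltn_count_ltn _ (mem_nth 0 lt_a)) -ltnS -!nth_red // eq_red.
by rewrite sz in lt_a lt_b; rewrite !nth_red // ltnS ltn_count_ltn ?mem_nth.
Qed.

Lemma eq_red s u : size s = size u ->
    (forall a b, a < size s -> b < size s ->
       (nth 0 s a < nth 0 s b) = (nth 0 u a < nth 0 u b)) ->
  red s = red u.
Proof.
move=> sz eq_lt; apply: (@eq_from_nth _ 0); rewrite !size_red // => a lt_a.
rewrite !nth_red -?sz //; congr S.
(* Both counts are taken over indices instead of values, so that they can be matched term by
   term. *)
rewrite -{2}(mkseq_nth 0 s) -{2}(mkseq_nth 0 u) !count_map -sz.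
by apply: eq_in_count => b; rewrite mem_iota /= add0n => lt_b; apply: eq_lt.
Qed.

Lemma red_delete_at s u p : p < size s -> red s = red u ->
  red (delete_at p s) = red (delete_at p u).
Proof.
move=> lt_p eq_su.
have sz : size s = size u by rewrite -(size_red s) eq_su size_red.
have lt_pu : p < size u by rewrite -sz.
apply: eq_red; rewrite !size_delete_at ?sz // => a b lt_a lt_b.
rewrite !nth_delete_at //; apply: red_nth_ltn => //; rewrite /bump; lia.
Qed.

Lemma red_red s : red (red s) = red s.
Proof.
apply: eq_red; rewrite size_red // => a b lt_a lt_b.
by rewrite !nth_red // ltnS ltn_count_ltn ?mem_nth.
Qed.

(** The two deletions differ only at index [i], where consecutive values stand; no other entry can
    separate these values. *)
Lemma red_delete_at_adjacent s i : uniq s -> i.+1 < size s ->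
    nth 0 s i = (nth 0 s i.+1).+1 \/ nth 0 s i.+1 = (nth 0 s i).+1 ->
  red (delete_at i s) = red (delete_at i.+1 s).
Proof.
move=> uniq_s lt_i adj; have lt_i' := ltnW lt_i.
have ne a b : a < size s -> b < size s -> a <> b -> nth 0 s a <> nth 0 s b.
  by move=> la lb ne_ab; apply/eqP; rewrite nth_uniq //; apply/eqP.
have bumpE a : a <> i -> bump i.+1 a = bump i a by rewrite /bump; lia.
have ltb a : a < (size s).-1 -> bump i a < size s by rewrite /bump; lia.
have bi : bump i i = i.+1 by rewrite /bump leqnn.
have bi1 : bump i.+1 i = i by rewrite /bump ltnn.
have far a : a < (size s).-1 -> a <> i ->
    nth 0 s (bump i a) <> nth 0 s i /\ nth 0 s (bump i a) <> nth 0 s i.+1.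
  by move=> la ne_a; split; apply: ne; rewrite ?ltb // /bump; lia.
apply: eq_red; rewrite !size_delete_at // => a b lt_a lt_b.
rewrite !nth_delete_at //.
case: (eqVneq a i) (far a lt_a) => [-> _ | /eqP ne_a /(_ ne_a) [fa fa']];
case: (eqVneq b i) (far b lt_b) => [-> _ | /eqP ne_b /(_ ne_b) [fb fb']];
  rewrite ?bi ?bi1 ?bumpE //; lia.
Qed.

(** * One-line notation and its deletions *)

Section OneLine.

Variables (k : nat) (tau : 'S_k).

Lemma size_oneline : size (oneline tau) = k.
Proof. by rewrite size_map size_enum_ord. Qed.

Lemma nth_oneline (x : 'I_k) : nth 0 (oneline tau) x = (tau x).+1.
Proof. by rewrite (nth_map x) ?size_enum_ord // nth_ord_enum. Qed.

Lemma oneline_uniq : uniq (oneline tau).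
Proof.
by rewrite map_inj_uniq ?enum_uniq // => x y [] /val_inj /perm_inj.
Qed.

Lemma count_oneline (x : 'I_k) :
  count (fun y => y < (tau x).+1) (oneline tau) = tau x.
Proof.
have perm_ol : perm_eq (oneline tau) [seq y.+1 | y <- iota 0 k].
  have -> : oneline tau = [seq y.+1 | y <- map val (map tau (enum 'I_k))].
    by rewrite -2!map_comp.
  rewrite -[iota 0 k]val_enum_ord; do 2!apply: perm_map.
  apply: uniq_perm => [||y].
  - by rewrite (map_inj_uniq (@perm_inj _ tau)) enum_uniq.
  - exact: enum_uniq.
  - by rewrite mem_enum -[y](permKV tau) map_f ?mem_enum.
rewrite (seq.permP perm_ol) count_map -size_filter.
by rewrite (@filter_iota_ltn 0 k (tau x)) ?size_iota // ltnW.
Qed.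

Lemma del_entryE (i : 'I_k) : del_entry tau i = delete_at i (oneline tau).
Proof.
rewrite /del_entry rem_delete_at -(nth_oneline i) index_uniq ?size_oneline //.
exact: oneline_uniq.
Qed.

(** Deletion lowers by one exactly the values above the deleted one. The additive form avoids
    truncated subtraction. *)
Lemma nth_red_delete_at_oneline (p x : 'I_k) a : bump p a = x ->
  nth 0 (red (delete_at p (oneline tau))) a + (tau p < tau x) = (tau x).+1.
Proof.
move=> eq_x; have lt_x := ltn_ord x; have lt_p := ltn_ord p.
have lt_p' : p < size (oneline tau) by rewrite size_oneline.
rewrite nth_red; last first.
  by rewrite size_delete_at // size_oneline; move: eq_x; rewrite /bump; lia.
rewrite nth_delete_at // eq_x nth_oneline addSn addnC.
by rewrite -[in RHS]count_oneline (count_delete_at _ 0 lt_p') nth_oneline ltnS.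
Qed.

Lemma red_delete_at_inj (i p : 'I_k) :
    (forall l : 'I_k, l.+1 = i \/ l = i.+1 :> nat ->
       (tau i).+1 <> (tau l).+1 - 1 /\ (tau i).+1 <> (tau l).+1 + 1) ->
    red (delete_at p (oneline tau)) = red (delete_at i (oneline tau)) ->
  p = i.
Proof.
move=> sep eq_red; apply/val_inj.
have adj (l : 'I_k) a : l.+1 = i \/ l = i.+1 :> nat ->
    bump p a = i -> bump i a = l -> False.
  (* The two equations put [tau i] and [tau l] within one of each other; [sep] excludes a difference
     of one, injectivity of [tau] a difference of zero. *)
  move=> near_l /nth_red_delete_at_oneline + /nth_red_delete_at_oneline.
  rewrite eq_red; have [] := sep l near_l.
  have : tau i <> tau l :> nat.
    by move=> /val_inj /perm_inj eq_il; move: near_l; rewrite eq_il; lia.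
  lia.
have lt_p := ltn_ord p; have lt_i := ltn_ord i.
(* Compare at index [i.-1], with the left neighbour, if [p < i], and at index [i], with the right
   neighbour, if [i < p]. *)
case: (ltngtP p i) => // [lt_pi | lt_ip]; exfalso.
  have lt_l : i.-1 < k by lia.
  by apply: (adj (Ordinal lt_l) i.-1); rewrite /bump /=; lia.
have lt_l : i.+1 < k by lia.
by apply: (adj (Ordinal lt_l) i); rewrite /bump /=; lia.
Qed.

End OneLine.

(** * Increasing sequences of positions *)

Section Increasing.

Variable n : nat.
Implicit Types (s t : seq 'I_n).

Let ltn_ord_trans : transitive (fun x y : 'I_n => x < y).
Proof. by move=> y x z; apply: ltn_trans. Qed.

Lemma increasing_uniq s : increasing s -> uniq s.
Proof. by apply: sorted_uniq => // x; apply: ltnn. Qed.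

Lemma increasing_enum : increasing (enum 'I_n).
Proof.
have -> : increasing (enum 'I_n) = sorted ltn (map val (enum 'I_n)).
  by rewrite sorted_map.
by rewrite val_enum_ord iota_ltn_sorted.
Qed.

Lemma increasing_delete_at p s : increasing s -> increasing (delete_at p s).
Proof. exact: (subseq_sorted ltn_ord_trans (subseq_delete_at p s)). Qed.

Lemma increasing_nth x0 s a b : increasing s -> a < b < size s ->
  nth x0 s a < nth x0 s b.
Proof.
move=> inc_s /andP[lt_ab lt_b].
by apply: (sorted_ltn_nth ltn_ord_trans x0 inc_s);
  rewrite ?inE // (ltn_trans lt_ab).
Qed.

Lemma increasing_insert p s (m : 'I_n) : increasing s -> p <= size s ->
    (0 < p -> nth m s p.-1 < m) -> (p < size s -> m < nth m s p) ->
  increasing (take p s ++ m :: drop p s).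
Proof.
move=> inc_s le_p lo hi.
have inc_d : path (fun x y : 'I_n => x < y) m (drop p s).
  have := drop_sorted p inc_s.
  case: (ltnP p (size s)) => [lt_p | ge_p]; last by rewrite drop_oversize.
  by rewrite (drop_nth m) //= hi // => ->.
rewrite /increasing; case def_t: (take p s) (take_sorted p inc_s) => [|x u] //=.
have sz : size (take p s) = p by rewrite size_takel.
rewrite cat_path /= inc_d => ->; rewrite andbT /=.
have p_gt0 : 0 < p by rewrite -sz def_t.
have -> : last x u = nth m s p.-1; last exact: lo.
by rewrite -(nth_take m (n0 := p)) ?def_t; [rewrite -sz def_t nth_last | lia].
Qed.

(** By pigeonhole [t] has an element outside [s]; without it, [t] has the same elements as [s], and
    an increasing sequence is determined by its elements. *)
Lemma increasing_subset_delete_at s t : increasing s -> increasing t ->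
    size t = (size s).+1 -> {subset s <= t} ->
  exists2 p, p < size t & s = delete_at p t.
Proof.
move=> inc_s inc_t sz_t sub_st.
have uniq_s := increasing_uniq inc_s; have uniq_t := increasing_uniq inc_t.
have /allPn[x t_x s'x] : ~~ all (fun x => x \in s) t.
  by apply/negP=> /allP /(uniq_leq_size uniq_t); rewrite sz_t ltnn.
exists (index x t); first by rewrite index_mem.
apply: (irr_sorted_eq ltn_ord_trans) => //; first by move=> y; apply: ltnn.
  exact: increasing_delete_at.
have [||_ eq_s] // := uniq_min_size uniq_s (s2 := delete_at (index x t) t).
  rewrite -rem_delete_at => y s_y; rewrite mem_rem_uniq // inE sub_st // andbT.
  by apply: contraNneq s'x => <-.
by rewrite size_delete_at ?index_mem // sz_t.
Qed.

End Increasing.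

(** * The two inclusions *)

Lemma S_bar_sub_hat n k (tau : 'S_k) (i : 'I_k) :
  S_bar n tau i \subset S_hat n tau i.
Proof.
have lt_i := ltn_ord i.
apply/subsetP=> pi; rewrite !inE => /forallP bar; apply/forallP=> j.
apply/implyP=> occ_j.
have /existsP[m /and3P[lo hi red_m]] := implyP (bar j) occ_j.
have sz_j : size j = k.-1 by rewrite size_tuple.
(* The bounds on [m] in barred avoidance are what makes this extension of [j] increasing. *)
set t := take i j ++ m :: drop i j.
have sz_t : size t == k.
  by rewrite size_cat /= size_takel ?size_drop sz_j; lia.
apply/existsP; exists (Tuple sz_t); apply/and3P; split=> //.
  case/andP: occ_j => inc_j _; apply: increasing_insert => //.
  - by rewrite sz_j; lia.
  - exact/implyP.
  - by rewrite sz_j => lt_ik; apply: (implyP hi); lia.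
apply/allP=> x j_x; rewrite -/(x \in t) mem_cat inE orbCA -mem_cat.
by rewrite cat_take_drop; apply/orP; right.
Qed.

Lemma S_hat_sub_bar n k (tau : 'S_k) (i : 'I_k) :
    (forall l : 'I_k, l.+1 = i \/ l = i.+1 :> nat ->
       (tau i).+1 <> (tau l).+1 - 1 /\ (tau i).+1 <> (tau l).+1 + 1) ->
  S_hat n tau i \subset S_bar n tau i.
Proof.
move=> sep; have lt_i := ltn_ord i.
apply/subsetP=> pi; rewrite !inE => /forallP hat; apply/forallP=> j.
apply/implyP=> occ_j.
have /existsP[t /and3P[inc_t sub_jt /eqP red_t]] := implyP (hat j) occ_j.
case/andP: occ_j => inc_j /eqP red_j.
have sz_t : size t = k by rewrite size_tuple.
have sz_j : size j = k.-1 by rewrite size_tuple.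
have [||p lt_p def_j] := increasing_subset_delete_at inc_j inc_t.
- by rewrite sz_t sz_j; lia.
- exact/allP.
rewrite sz_t in lt_p.
(* Deleting index [p] from the occurrence [t] of [tau] gives an occurrence of [tau] without its
   entry at [p]; as [j] is also one of [tau] without its entry at [i], the two patterns agree. *)
have def_p : Ordinal lt_p = i.
  apply: red_delete_at_inj sep _ => /=; rewrite -del_entryE -red_j def_j.
  rewrite /entries map_delete_at; apply/esym/red_delete_at.
    by rewrite size_map sz_t.
  by rewrite -red_t red_red.
have {}def_j : tval j = delete_at i t by rewrite def_j -def_p.
have [x0 _] : exists x0 : 'I_n, x0 \in tval t.
  by exists (tnth t i); apply: mem_tnth.
(* The position of [t] missing from [j] fills the gap at [i]. *)
apply/existsP; exists (nth x0 t i).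
have lt_it : i < size t by rewrite sz_t.
rewrite def_j cat_delete_at // red_t eqxx andbT !nth_delete_at //.
apply/andP; split; apply/implyP=> lt.
  rewrite (_ : bump i i.-1 = i.-1); last by rewrite /bump; lia.
  by rewrite (set_nth_default x0) ?increasing_nth // sz_t; lia.
rewrite (_ : bump i i = i.+1); last by rewrite /bump; lia.
by rewrite (set_nth_default x0) ?increasing_nth // sz_t; lia.
Qed.

(** * The permutation [tau] as a separating example *)

Lemma avoids_hat_self k (tau : 'S_k) (i : 'I_k) : avoids_hat tau tau i.
Proof.
apply/forallP=> j; apply/implyP=> _; apply/existsP.
have sz : size (enum 'I_k) == k by rewrite size_enum_ord.
exists (Tuple sz); apply/and3P; split; first exact: increasing_enum.
  by apply/allP=> x _; rewrite [_ \in _]mem_enum.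
rewrite /= -/(oneline tau).
(* The string of [tau] is its own reduction: an entry [v] has [v - 1] smaller entries. *)
apply/eqP/(@eq_from_nth _ 0); first exact: size_red.
rewrite size_red size_oneline => a lt_a; rewrite nth_red ?size_oneline //.
by rewrite (nth_oneline tau (Ordinal lt_a)) count_oneline.
Qed.

Lemma not_avoids_bar_self k (tau : 'S_k) (i l : 'I_k) :
    l.+1 = i \/ l = i.+1 :> nat ->
    tau i = (tau l).+1 :> nat \/ tau l = (tau i).+1 :> nat ->
  ~~ avoids_bar tau tau i.
Proof.
move=> near adj; have lt_i := ltn_ord i; have lt_l := ltn_ord l.
have sz : size (delete_at l (enum 'I_k)) == k.-1.
  by rewrite size_delete_at size_enum_ord.
apply/forallPn; exists (Tuple sz); rewrite negb_imply; apply/andP; split.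
  apply/andP; split; first exact/increasing_delete_at/increasing_enum.
  rewrite del_entryE /entries map_delete_at -/(oneline tau) eq_sym; apply/eqP.
  have red_adj (x y : 'I_k) : y = x.+1 :> nat ->
      tau x = (tau y).+1 :> nat \/ tau y = (tau x).+1 :> nat ->
      red (delete_at x (oneline tau)) = red (delete_at y (oneline tau)).
    move=> eq_y adj_xy; rewrite eq_y; apply: red_delete_at_adjacent.
    - exact: oneline_uniq.
    - by rewrite size_oneline -eq_y.
    - by rewrite -eq_y !nth_oneline; lia.
  case: near => [eq_i | eq_l]; last exact: red_adj.
  by apply/esym/red_adj => //; lia.
apply/existsPn=> m; have lt_m := ltn_ord m.
rewrite /= !nth_delete_at ?size_enum_ord //; apply/negP=> /and3P[lo hi _].
have nthE a : a < k -> nth m (enum 'I_k) a = a :> nat by exact: nth_enum_ord.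
(* With [l] deleted, the gap at [i] is bounded by positions [i] and [i.+1] if [l] is on the left,
   and by [i.-1] and [i] if it is on the right. At an end of the string the missing bound is the
   range of [m] itself. *)
case: near => [eq_i | eq_l].
  move: lo; rewrite (_ : bump l i.-1 = i); last by rewrite /bump; lia.
  rewrite nthE // -eq_i /= => lt_im; move: hi.
  rewrite (_ : bump l i = i.+1); last by rewrite /bump; lia.
  by case: ltnP => [lt_ik /= | ]; [rewrite nthE | ]; lia.
move: hi; rewrite (_ : bump l i = i); last by rewrite /bump; lia.
rewrite nthE // -eq_l lt_l /= => lt_mi; move: lo.
rewrite (_ : bump l i.-1 = i.-1); last by rewrite /bump; lia.
by rewrite nthE; lia.
Qed.

Theorem proposition3 (k : nat) (tau : 'S_k) (i : 'I_k) :
  (forall n : nat, 0 < n -> S_hat n tau i = S_bar n tau i) <->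
  (forall l : 'I_k, l.+1 = i \/ l = i.+1 :> nat ->
     (tau i).+1 <> (tau l).+1 - 1 /\ (tau i).+1 <> (tau l).+1 + 1).
Proof.
split=> [eq_hat_bar l near | sep n _]; last first.
  by apply/eqP; rewrite eqEsubset S_hat_sub_bar //= S_bar_sub_hat.
have k_gt0 : 0 < k by apply: leq_ltn_trans (ltn_ord i).
(* The instance [n = k] of the equality already forces the condition. *)
have : tau \in S_bar k tau i by rewrite -eq_hat_bar // inE avoids_hat_self.
rewrite inE => bar.
by split=> adj; apply: (elimN idP (not_avoids_bar_self near _)) bar; lia.
Qed.
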